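(* Let $k\geq 2$ be an integer, let $a_1,\dots,a_{k-1}\in\mathbb{Z}$, and let $(x_n)_{n\geq 0}$ be the $k$th-order linear recurrence satisfying $$x_n=a_1x_{n-1}+a_2x_{n-2}+\dots+a_{k-1}x_{n-k+1}+x_{n-k}$$ for all integers $n\geq k$, with initial values $x_0=x_1=\dots=x_{k-2}=0$ and $x_{k-1}=1$. Suppose that the characteristic polynomial $$x^k-a_1x^{k-1}-a_2x^{k-2}-\dots-a_{k-1}x-1$$ of the recurrence has a root equal to $\alpha$ or $-\alpha$, where $\alpha$ is a Pisot number. If $p$ is a prime such that this characteristic polynomial is irreducible over $\mathbb{Q}_p$, then the quotient set $R((x_n)_{n\geq 0})$ is dense in $\mathbb{Q}_p$.
   Context: For a set of integers $A$, the quotient set (ratio set) of $A$ is $R(A)=\{a/b : a,b\in A,\ b\neq 0\}$; for a sequence $(x_n)_{n\ge 0}$ of integers, its quotient set $R((x_n)_{n\ge0})$ is $R(\{x_n : n\geq 0\})$. $\mathbb{Q}_p$ is the field of $p$-adic numbers, and denseness is with respect to the $p$-adic metric, with $R(A)\subset\mathbb{Q}\subset\mathbb{Q}_p$. A Pisot number is a real algebraic integer greater than $1$ all of whose other conjugates (over $\mathbb{Q}$, in $\mathbb{C}$) have absolute value less than $1$. *)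

(* Defs.v *)
From HB Require Import structures.
From mathcomp Require Import all_boot all_order all_algebra all_field.
From mathcomp Require Import boolp classical_sets.
From mathcomp Require Import topology_theory.topology_structure.
From mathcomp Require Import topology_theory.uniform_structure.
From mathcomp Require Import topology_theory.pseudometric_structure.
From mathcomp Require Import topology_theory.metric_structure.

Set Implicit Arguments.
Unset Strict Implicit.
Unset Printing Implicit Defensive.

Import Order.TTheory GRing.Theory Num.Theory.
Local Open Scope ring_scope.

(* The ring of p-adic integers, as the inverse limit of the Z/p^nZ.
   The [n]-th component is the representative in [0, p ^ n) of the residue
   modulo [p ^ n]; the bounds follow from the compatibility condition. *)
Record padic_int (p : nat) (hp : prime p) := PadicInt {
  residue :> nat -> int;
  residue_compat : forall n, residue n = (residue n.+1 %% (p ^ n)%N)%Z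
}.

Section PadicInt.
Variables (p : nat) (hp : prime p).
Local Notation Zp := (padic_int hp).
Implicit Types x y z : Zp.

HB.instance Definition _ := gen_eqMixin Zp.
HB.instance Definition _ := gen_choiceMixin Zp.

Lemma padic_int_ext x y : (forall n, x n = y n) -> x = y.
Proof.
case: x y => [x xP] [y yP] /= /funext exy.
by subst y; congr PadicInt; exact: Prop_irrelevance.
Qed.

Lemma residue_mod x n : (x n %% (p ^ n)%N)%Z = x n.
Proof. by rewrite {1}(residue_compat x n) modz_mod -residue_compat. Qed.

Lemma modz_modl (d e m : int) : (d %| e)%Z -> ((m %% e)%Z %% d)%Z = (m %% d)%Z.
Proof.
move=> /dvdzP[q ->]; rewrite {2}(divz_eq m (q * d)) mulrA.
by rewrite modzMDl.
Qed.

Lemma dvdz_expS n : ((p ^ n)%N %| Posz (p ^ n.+1)%N)%Z.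
Proof. by rewrite dvdzE /= dvdn_exp2l. Qed.

Lemma residue_le x m n : (m <= n)%N -> x m = (x n %% (p ^ m)%N)%Z.
Proof.
move=> /subnK <-; elim: (n - m)%N => [|d IH]; first by rewrite residue_mod.
rewrite addSn IH residue_compat modz_modl // dvdzE /=.
by rewrite dvdn_exp2l // leq_addl.
Qed.

Fact compat_mod (u : nat -> int) :
    (forall n, u n = u n.+1 %[mod (p ^ n)%N])%Z ->
  forall n, ((u n) %% (p ^ n)%N)%Z =
            ((u n.+1 %% (p ^ n.+1)%N)%Z %% (p ^ n)%N)%Z.
Proof. by move=> h n; rewrite modz_modl ?dvdz_expS. Qed.

Definition padic_int_of (u : nat -> int)
    (hu : forall n, (u n = u n.+1 %[mod (p ^ n)%N])%Z) : Zp :=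
  PadicInt hp (compat_mod hu).

Fact const_compat (a : int) n : (a = a %[mod (p ^ n)%N])%Z.
Proof. by []. Qed.

Fact add_compat x y n : (x n + y n = x n.+1 + y n.+1 %[mod (p ^ n)%N])%Z.
Proof. by rewrite (residue_compat x) (residue_compat y) modzDm. Qed.

Fact opp_compat x n : (- x n = - x n.+1 %[mod (p ^ n)%N])%Z.
Proof. by rewrite (residue_compat x) modzNm. Qed.

Fact mul_compat x y n : (x n * y n = x n.+1 * y n.+1 %[mod (p ^ n)%N])%Z.
Proof. by rewrite (residue_compat x) (residue_compat y) modzMm. Qed.

Definition padic_int_const (a : int) : Zp := padic_int_of (const_compat a).
Definition padic_int_add x y : Zp := padic_int_of (add_compat x y).
Definition padic_int_opp x : Zp := padic_int_of (opp_compat x).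
Definition padic_int_mul x y : Zp := padic_int_of (mul_compat x y).

Fact padic_int_addA : associative padic_int_add.
Proof.
by move=> x y z; apply: padic_int_ext => n /=; rewrite modzDmr modzDml addrA.
Qed.

Fact padic_int_addC : commutative padic_int_add.
Proof. by move=> x y; apply: padic_int_ext => n /=; rewrite addrC. Qed.

Fact padic_int_add0 : left_id (padic_int_const 0) padic_int_add.
Proof.
by move=> x; apply: padic_int_ext => n /=; rewrite mod0z add0r residue_mod.
Qed.

Fact padic_int_addN :
  left_inverse (padic_int_const 0) padic_int_opp padic_int_add.
Proof.
by move=> x; apply: padic_int_ext => n /=; rewrite modzDml addNr.
Qed.

HB.instance Definition _ := GRing.isZmodule.Build Zp
  padic_int_addA padic_int_addC padic_int_add0 padic_int_addN.

Fact padic_int_mulA : associative padic_int_mul.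
Proof.
by move=> x y z; apply: padic_int_ext => n /=; rewrite modzMmr modzMml mulrA.
Qed.

Fact padic_int_mulC : commutative padic_int_mul.
Proof. by move=> x y; apply: padic_int_ext => n /=; rewrite mulrC. Qed.

Fact padic_int_mul1 : left_id (padic_int_const 1) padic_int_mul.
Proof.
by move=> x; apply: padic_int_ext => n /=; rewrite modzMml mul1r residue_mod.
Qed.

Fact padic_int_mulDl : left_distributive padic_int_mul padic_int_add.
Proof.
by move=> x y z; apply: padic_int_ext => n /=; rewrite modzMml modzDm mulrDl.
Qed.

Fact padic_int_1neq0 : padic_int_const 1 != 0.
Proof.
apply/eqP => /(congr1 (fun x : Zp => x 1)) /=.
by rewrite expn1 mod0z modz_small //= ltz_nat prime_gt1.
Qed.

HB.instance Definition _ := GRing.Zmodule_isComNzRing.Build Zp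
  padic_int_mulA padic_int_mulC padic_int_mul1 padic_int_mulDl padic_int_1neq0.

Lemma residue0 n : (0 : Zp) n = 0. Proof. exact: mod0z. Qed.
Lemma residue1 n : (1 : Zp) n = (1 %% (p ^ n)%N)%Z. Proof. by []. Qed.
Lemma residueD x y n : (x + y) n = ((x n + y n) %% (p ^ n)%N)%Z.
Proof. by []. Qed.
Lemma residueN x n : (- x) n = (- x n %% (p ^ n)%N)%Z. Proof. by []. Qed.
Lemma residueM x y n : (x * y) n = ((x n * y n) %% (p ^ n)%N)%Z.
Proof. by []. Qed.

Lemma residue_int (a : int) n : (a%:~R : Zp) n = (a %% (p ^ n)%N)%Z.
Proof.
have nat_case (m : nat) : (m%:R : Zp) n = (m %% (p ^ n)%N)%Z.
  elim: m => [|m IH]; first by rewrite residue0 mod0z.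
  by rewrite -addn1 natrD residueD IH residue1 modzDm PoszD.
by case: a => m; [exact: nat_case | rewrite NegzE mulrNz residueN nat_case modzNm].
Qed.

Lemma residue_anti x m n : (m <= n)%N -> x n = 0 -> x m = 0.
Proof. by move=> lemn xn0; rewrite (residue_le x lemn) xn0 mod0z. Qed.

Definition valuation_is x n := x n = 0 /\ x n.+1 <> 0.

Lemma valuation_exists x : x <> 0 -> exists n, valuation_is x n.
Proof.
move=> x0.
have ex : exists n, x n != 0.
  apply: contrapT => h; apply: x0; apply: padic_int_ext => n.
  rewrite residue0; apply: contrapT => /eqP xn; apply: h; by exists n.
case: (ex_minnP ex) => [[|n] xn min]; first by rewrite -residue_mod modz1 in xn.
exists n; split; last exact/eqP.
by apply/eqP; apply: contraT => /min; rewrite ltnn.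
Qed.

Lemma valuation_isP x m n : valuation_is x n -> (x m = 0 <-> (m <= n)%N).
Proof.
move=> [xn xSn]; split=> [xm|/residue_anti]; last exact.
by rewrite leqNgt; apply/negP => /residue_anti /(_ xm).
Qed.

Lemma valuation_isM x y m n :
  valuation_is x m -> valuation_is y n -> valuation_is (x * y) (m + n).
Proof.
move=> [xm xSm] [yn ySn].
have dvdE z k l : (k <= l)%N -> (z k == 0) = ((p ^ k)%N %| z l)%Z.
  by move=> kl; rewrite (residue_le z kl); apply/eqP/dvdz_mod0P.
have dvdME k : (k <= (m + n).+1)%N ->
    ((x * y) k == 0) = ((p ^ k)%N %| x (m + n).+1 * y (m + n).+1)%Z.
  move=> kl; rewrite (residue_le _ kl) residueM modz_modl ?dvdzE ?dvdn_exp2l //.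
  by apply/eqP/dvdz_mod0P.
have mN : (m < (m + n).+1)%N by rewrite ltnS leq_addr.
have nN : (n < (m + n).+1)%N by rewrite ltnS leq_addl.
have [u xu] : exists u : int, x (m + n).+1 = u * Posz (p ^ m).
  by apply/dvdzP; rewrite -(dvdE _ _ _ (ltnW mN)); apply/eqP.
have [v yv] : exists v : int, y (m + n).+1 = v * Posz (p ^ n).
  by apply/dvdzP; rewrite -(dvdE _ _ _ (ltnW nN)); apply/eqP.
have pk k : (p ^ k)%N != 0 :> int by rewrite eqz_nat expn_eq0 negb_and -lt0n prime_gt0.
have pu : ~~ (p %| u)%Z.
  apply/negP; rewrite -(dvdz_mul2r (pk m)) => h.
  by apply: xSm; apply/eqP; rewrite (dvdE _ _ _ mN) xu expnS PoszM h.
have pv : ~~ (p %| v)%Z.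
  apply/negP; rewrite -(dvdz_mul2r (pk n)) => h.
  by apply: ySn; apply/eqP; rewrite (dvdE _ _ _ nN) yv expnS PoszM h.
have xyE : x (m + n).+1 * y (m + n).+1 = u * v * Posz (p ^ (m + n)).
  by rewrite xu yv expnD PoszM mulrACA.
split; apply/eqP; rewrite dvdME ?leqnSn // xyE; first exact: dvdz_mull.
rewrite expnS PoszM (dvdz_mul2r (pk _)) dvdzE abszM /= Euclid_dvdM //.
by rewrite negb_or; apply/andP.
Qed.

Fact padic_int_idomain x y : x * y = 0 -> (x == 0) || (y == 0).
Proof.
move=> xy0; apply: contraT; rewrite negb_or => /andP[/eqP x0 /eqP y0].
have [m xm] := valuation_exists x0; have [n yn] := valuation_exists y0.
by have [_] := valuation_isM xm yn; rewrite xy0 residue0.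
Qed.

Definition padic_int_unit : pred Zp := fun x => `[< exists y, y * x = 1 >].

Definition padic_int_inv x : Zp :=
  if pselect (exists y, y * x = 1) is left ex then sval (cid ex) else x.

Fact padic_int_mulV : {in padic_int_unit, left_inverse 1 padic_int_inv *%R}.
Proof.
move=> x /asboolP ex; rewrite /padic_int_inv.
by case: pselect => // ex'; case: cid.
Qed.

Fact padic_int_unitP x y : y * x = 1 -> padic_int_unit x.
Proof. by move=> yx; apply/asboolP; exists y. Qed.

Fact padic_int_inv_out : {in [predC padic_int_unit], padic_int_inv =1 id}.
Proof.
move=> x; rewrite inE => /asboolPn nex; rewrite /padic_int_inv.
by case: pselect.
Qed.

HB.instance Definition _ := GRing.ComNzRing_hasMulInverse.Build Zp
  padic_int_mulV padic_int_unitP padic_int_inv_out.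

HB.instance Definition _ :=
  GRing.ComUnitRing_isIntegral.Build Zp padic_int_idomain.

(* [ex_minn ex] is the p-adic valuation of [x]: the largest [n] such that
   [x] vanishes modulo [p ^ n]. *)
Definition padic_int_abs x : rat :=
  if pselect (exists n, x n.+1 != 0) is left ex then p%:R ^- ex_minn ex else 0.

Let p_gt0 k : 0 < (p%:R : rat) ^+ k.
Proof. by rewrite exprn_gt0 // ltr0n prime_gt0. Qed.

Lemma padic_int_abs0 : padic_int_abs 0 = 0.
Proof.
rewrite /padic_int_abs; case: pselect => // ex; exfalso.
by case: ex => n; rewrite residue0 eqxx.
Qed.

Lemma padic_int_abs_valuation x n :
  valuation_is x n -> padic_int_abs x = p%:R ^- n.
Proof.
move=> xn; rewrite /padic_int_abs; case: pselect => [ex|[]]; last first.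
  by exists n; apply/eqP; case: xn.
case: ex_minnP => m xm min; congr (_ ^- _); apply/eqP; rewrite eqn_leq.
rewrite min; last by apply/eqP; case: xn.
by rewrite leqNgt; apply: contra xm => /(valuation_isP m.+1 xn) ->.
Qed.

Lemma padic_int_abs_ge0 x : 0 <= padic_int_abs x.
Proof.
by rewrite /padic_int_abs; case: pselect => // ex; rewrite invr_ge0 ltW.
Qed.

Lemma padic_int_abs_eq0 x : (padic_int_abs x == 0) = (x == 0).
Proof.
have [->|/eqP /valuation_exists[n xn]] := eqVneq x 0.
  by rewrite padic_int_abs0 eqxx.
by rewrite (padic_int_abs_valuation xn) invr_eq0 gt_eqF.
Qed.

Lemma padic_int_absM x y :
  padic_int_abs (x * y) = padic_int_abs x * padic_int_abs y.
Proof.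
have [->|/eqP /valuation_exists[m xm]] := eqVneq x 0.
  by rewrite mul0r padic_int_abs0 mul0r.
have [->|/eqP /valuation_exists[n yn]] := eqVneq y 0.
  by rewrite mulr0 padic_int_abs0 mulr0.
rewrite (padic_int_abs_valuation xm) (padic_int_abs_valuation yn).
by rewrite (padic_int_abs_valuation (valuation_isM xm yn)) exprD invfM.
Qed.

Lemma padic_int_abs_le x n : (padic_int_abs x <= p%:R ^- n) = (x n == 0).
Proof.
have [->|/eqP /valuation_exists[m xm]] := eqVneq x 0.
  by rewrite padic_int_abs0 residue0 eqxx invr_ge0 ltW.
rewrite (padic_int_abs_valuation xm) lef_pV2 ?posrE //.
rewrite ler_eXn2l ?ltr1n ?prime_gt1 //.
by apply/idP/eqP => /(valuation_isP n xm).
Qed.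

Lemma padic_int_absD x y :
  padic_int_abs (x + y) <= Num.max (padic_int_abs x) (padic_int_abs y).
Proof.
wlog le_xy : x y / padic_int_abs x <= padic_int_abs y => [IH|].
  have /orP[/IH //|/IH] := le_total (padic_int_abs x) (padic_int_abs y).
  by rewrite addrC maxC.
rewrite (max_idPr le_xy); have [y0|/eqP /valuation_exists[n yn]] := eqVneq y 0.
  by move: le_xy; rewrite y0 addr0.
move: le_xy; rewrite (padic_int_abs_valuation yn) !padic_int_abs_le residueD.
by move=> /eqP ->; case: yn => -> _; rewrite addr0 mod0z.
Qed.

Lemma padic_int_abs1 : padic_int_abs 1 = 1.
Proof.
rewrite (@padic_int_abs_valuation _ 0) ?expr0 ?invr1 //; split.
  by rewrite residue1 modz1.
by rewrite residue1 modz_small //= ltz_nat -[ltnLHS](expn0 p) ltn_exp2l ?prime_gt1.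
Qed.

Lemma padic_int_absN x : padic_int_abs (- x) = padic_int_abs x.
Proof.
rewrite -mulN1r padic_int_absM; suff -> : padic_int_abs (-1) = 1 by rewrite mul1r.
apply/eqP; rewrite -(@eqrXn2 _ 2) ?padic_int_abs_ge0 // expr2 -padic_int_absM.
by rewrite mulrNN mulr1 padic_int_abs1 expr1n.
Qed.

End PadicInt.

Definition padic (p : nat) (hp : prime p) := {fraction (padic_int hp)}.

Section Padic.
Variables (p : nat) (hp : prime p).
Local Notation Qp := (padic hp).
Local Notation Zp := (padic_int hp).
Local Notation "x %:F" := (@FracField.tofrac Zp x).
Local Open Scope quotient_scope.
Implicit Types x y z : Qp.

HB.instance Definition _ := GRing.Field.on Qp.

Definition padic_abs x : rat :=
  padic_int_abs \n_(repr x) / padic_int_abs \d_(repr x).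

Lemma padic_reprE x :
  x = (\n_(repr x))%:F / (\d_(repr x))%:F.
Proof.
rewrite -[LHS]reprK; case: (repr x) => -[a b] /= b0.
apply: (canRL (mulfK _)); first by rewrite tofrac_eq0.
unlock FracField.tofrac; rewrite -[LHS]FracField.pi_mul /FracField.mulf /=.
rewrite !numden_Ratio ?oner_neq0 // !mulr1.
apply/eqmodP; rewrite /= FracField.equivfE /= !numden_Ratio ?oner_neq0 //.
by rewrite mulr1 mulrC.
Qed.

Lemma padic_abs_frac (a b : Zp) :
  b != 0 -> padic_abs (a%:F / b%:F) = padic_int_abs a / padic_int_abs b.
Proof.
move=> b0; set x := _ / _; have := padic_reprE x.
have d0 := denom_ratioP (repr x); rewrite /padic_abs.
move: (\n_(repr x)) (\d_(repr x)) d0 => c d d0 /eqP.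
rewrite {}/x eqr_div ?tofrac_eq0 // -!tofracM tofrac_eq => /eqP eq_ad.
apply/eqP; rewrite eqr_div ?padic_int_abs_eq0 // -!padic_int_absM.
by rewrite eq_ad.
Qed.

Lemma padic_fracP x : exists a b : Zp, b != 0 /\ x = a%:F / b%:F.
Proof.
exists (\n_(repr x)), (\d_(repr x)); split; last exact: padic_reprE.
exact: denom_ratioP.
Qed.

Lemma padic_abs_ge0 x : 0 <= padic_abs x.
Proof. by rewrite divr_ge0 // padic_int_abs_ge0. Qed.

Lemma padic_abs_eq0 x : (padic_abs x == 0) = (x == 0).
Proof.
have [a [b [b0 ->]]] := padic_fracP x.
rewrite padic_abs_frac // !mulf_eq0 !invr_eq0 !padic_int_abs_eq0 !tofrac_eq0.
by [].
Qed.

Lemma padic_absM x y : padic_abs (x * y) = padic_abs x * padic_abs y.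
Proof.
have [a [b [b0 ->]]] := padic_fracP x; have [c [d [d0 ->]]] := padic_fracP y.
rewrite mulf_div -!tofracM !padic_abs_frac ?mulf_neq0 //.
by rewrite !padic_int_absM mulf_div.
Qed.

Lemma padic_abs_tofrac (a : Zp) : padic_abs a%:F = padic_int_abs a.
Proof.
by rewrite -[a%:F]divr1 -tofrac1 padic_abs_frac ?oner_neq0 // padic_int_abs1 divr1.
Qed.

Lemma padic_absN x : padic_abs (- x) = padic_abs x.
Proof.
rewrite -mulN1r padic_absM -tofrac1 -tofracN padic_abs_tofrac.
by rewrite padic_int_absN padic_int_abs1 mul1r.
Qed.

Lemma padic_absD x y :
  padic_abs (x + y) <= Num.max (padic_abs x) (padic_abs y).
Proof.
have [a [b [b0 ->]]] := padic_fracP x; have [c [d [d0 ->]]] := padic_fracP y.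
rewrite addf_div ?tofrac_eq0 // -!tofracM -tofracD.
rewrite !padic_abs_frac ?mulf_neq0 //.
have ab : padic_int_abs a / padic_int_abs b =
          padic_int_abs (a * d) / padic_int_abs (b * d).
  by rewrite !padic_int_absM -mulf_div divff ?mulr1 // padic_int_abs_eq0.
have cd : padic_int_abs c / padic_int_abs d =
          padic_int_abs (c * b) / padic_int_abs (b * d).
  rewrite [b * d]mulrC !padic_int_absM -mulf_div divff ?mulr1 //.
  by rewrite padic_int_abs_eq0.
rewrite ab cd -maxr_pMl ?invr_ge0 ?padic_int_abs_ge0 //.
by rewrite ler_wpM2r ?invr_ge0 ?padic_int_abs_ge0 // padic_int_absD.
Qed.

Definition padic_dist x y : rat := padic_abs (x - y).

Fact padic_distxx x : padic_dist x x = 0.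
Proof. by apply/eqP; rewrite padic_abs_eq0 subrr. Qed.

Fact padic_dist_eq0 x y : padic_dist x y = 0 -> x = y.
Proof. by move=> /eqP; rewrite padic_abs_eq0 subr_eq0 => /eqP. Qed.

Fact padic_dist_sym x y : padic_dist x y = padic_dist y x.
Proof. by rewrite /padic_dist -opprB padic_absN. Qed.

Fact padic_dist_triangle y x z :
  padic_dist x z <= padic_dist x y + padic_dist y z.
Proof.
rewrite /padic_dist -(subrKA y); apply: le_trans (padic_absD _ _) _.
by rewrite ge_max lerDl lerDr !padic_abs_ge0.
Qed.

HB.instance Definition _ := isMetric.Build rat Qp
  padic_distxx padic_dist_eq0 padic_dist_sym padic_dist_triangle.

Lemma padic_abs_int (a : int) :
  a != 0 -> padic_abs a%:~R = p%:R ^- logn p `|a|%N.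
Proof.
move=> a0; rewrite -(rmorph_int (@FracField.tofrac Zp)) padic_abs_tofrac.
have resE n : ((a%:~R : Zp) n == 0) = (n <= logn p `|a|)%N.
  rewrite residue_int -pfactor_dvdn ?absz_gt0 //.
  exact: (sameP eqP dvdz_mod0P).
by apply: padic_int_abs_valuation; split; apply/eqP; rewrite resE // ltnn.
Qed.

(* Characteristic 0 makes [ratr] the embedding of [rat] in [Qp]. *)
Lemma padic_pchar : [pchar Qp] =i pred0.
Proof.
move=> q; apply/negP; rewrite inE => /andP[q_pr].
rewrite -padic_abs_eq0 pmulrn padic_abs_int ?gt_eqF ?ltz_nat ?prime_gt0 //.
by rewrite invr_gt0 exprn_gt0 // ltr0n prime_gt0.
Qed.

End Padic.

Definition quotient_set (A : set int) : set rat :=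
  [set q | exists a b : int, [/\ A a, A b, b != 0 & q = a%:~R / b%:~R]]%classic.

(* [minCpoly alpha] is the minimal polynomial of [alpha] over the rationals,
   so that its roots are the conjugates of [alpha]. *)
Definition pisot (alpha : algC) : Prop :=
  [/\ alpha \in Aint, alpha \is Num.real, 1 < alpha &
      forall beta : algC,
        root (minCpoly alpha) beta -> beta != alpha -> `|beta| < 1].

(* Only [a 1], ..., [a (k - 1)] are used; the coefficient of order [k] is 1. *)
Definition recurrence_poly (k : nat) (a : nat -> int) : {poly int} :=
  'X^k - \sum_(1 <= i < k) a i *: 'X^(k - i) - 1.

(* Main.v *)
(* Let [C] be the companion matrix shifting the state vectors
   [v_n = (x_n, ..., x_(n+k-1))]; its determinant is [+-1], so modulo every
   power of [p] some even power of [C] is the identity, whereas [C ^ m <> 1]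
   because [C] has an eigenvalue of modulus [alpha > 1].  Write
   [C ^ m = 1 + p ^ s G] with [s] large and [G] not divisible by [p].
   If the first [k - 1] entries of [G v_0] were all divisible by [p ^ e], then
   [G v_0 = c v_0] modulo [p ^ e], and [G = c] modulo [p ^ e] because [v_0] is a
   cyclic vector of [C]; taking determinants, [p ^ e] would divide [k c] while
   [p] does not divide [c].  Hence, once [p ^ e] does not divide [k], some
   [r <= k - 2] gives [x_(m n + r) = n t] modulo [p ^ (2 s)] with [p ^ (s + e)]
   not dividing [t]: the numbers [x_l / t] approximate all natural numbers
   [p]-adically, and their quotients approximate all of [Q_p]. *)
Require Import Defs.
From mathcomp Require Import all_boot all_order all_algebra all_field.
From mathcomp Require Import fingroup.
From mathcomp Require Import zify ring.
From mathcomp Require Import boolp classical_sets topology.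

Local Open Scope classical_set_scope.
Local Open Scope ring_scope.

Import Order.TTheory GRing.Theory Num.Theory.

(** * Integer matrices modulo [N] and powers of [1 + u] *)

Lemma intr_Zp_eq0 (N : nat) (a : int) :
  (1 < N)%N -> ((a%:~R : 'Z_N) == 0) = (N %| a)%Z.
Proof.
move=> N1; have nat_case (m : nat) : ((m%:R : 'Z_N) == 0) = (N %| m)%N.
  by rewrite -val_eqE /= val_Zp_nat.
case: a => m; first by rewrite dvdzE /= -nat_case.
by rewrite NegzE mulrNz oppr_eq0 dvdzE abszN /= -nat_case.
Qed.

Lemma dvdz_mxP (m n : nat) (N : int) (A : 'M[int]_(m, n)) :
  (forall i j, (N %| A i j)%Z) -> exists B, A = N *: B.
Proof.
move=> dvdA; exists (\matrix_(i, j) (A i j %/ N)%Z); apply/matrixP => i j.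
by rewrite !mxE mulrC divzK.
Qed.

Lemma dvdz_detB (n N : nat) (A B D : 'M[int]_n) :
  (1 < N)%N -> A = B + N%:Z *: D -> (N %| \det A - \det B)%Z.
Proof.
move=> N1 eqA; rewrite -intr_Zp_eq0 // rmorphB /= -!det_map_mx eqA.
rewrite (_ : map_mx _ (B + _) = map_mx intr B) ?subrr //.
apply/matrixP => i j; rewrite !mxE rmorphD rmorphM /=.
rewrite [N%:~R](_ : _ = 0) ?mul0r ?addr0 //.
by apply/eqP; rewrite intr_Zp_eq0.
Qed.

(** Reduced modulo [N], the matrix [A] lies in a finite group of units; [m] is its order there. *)
Lemma unitmx_exp_mod (n N : nat) (A : 'M[int]_n.+1) :
    (1 < N)%N -> A \in unitmx ->
  exists m D, (0 < m)%N /\ A ^+ m = 1 + N%:Z *: D.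
Proof.
move=> N1 uA; pose f := map_mx (intr : int -> 'Z_N).
have ufA : f n.+1 n.+1 A \in unitmx.
  by rewrite unitmxE det_map_mx rmorph_unit // -unitmxE.
pose u : {unit 'M['Z_N]_n.+1} := FinRing.unit _ ufA.
exists #[u]%g; suff [D eD] : exists D, A ^+ #[u]%g - 1 = N%:Z *: D.
  by exists D; rewrite -eD addrC subrK.
apply: dvdz_mxP => i j; rewrite -intr_Zp_eq0 //.
have := congr1 val (expg_order u); rewrite FinRing.val_unitX /=.
rewrite /f -rmorphXn => /matrixP /(_ i j); rewrite !mxE rmorphB /= => ->.
by rewrite rmorph_nat subrr.
Qed.

(** Second-order binomial expansion, used both for integer matrices and for integers. *)
Lemma expr1D_sqr (R : pzRingType) (u : R) (n : nat) :
  exists w, (1 + u) ^+ n = 1 + u *+ n + u ^+ 2 * w.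
Proof.
elim: n => [|n [w ew]]; first by exists 0; rewrite mulr0n mulr0 !addr0.
exists (n%:R + w * (1 + u)).
rewrite exprSr ew mulrDl [in RHS]mulrDr mulrA addrA; congr (_ + _).
by rewrite mulrDl mul1r mulrDr mulr1 mulrnAl -expr2 mulr_natr mulrS !addrA.
Qed.

(** The exponent [s] is the largest one for which [p ^ s] divides every entry; any nonzero entry
    bounds it. *)
Lemma mx_primitive_part (p n S : nat) (A D : 'M[int]_n) :
    (1 < p)%N -> A != 0 -> A = (p ^ S)%N%:Z *: D ->
  exists s G, [/\ (S <= s)%N, A = (p ^ s)%N%:Z *: G &
                  forall E, G <> p%:Z *: E].
Proof.
move=> p1 A0 AD.
pose P s := [forall i, forall j, ((p ^ s)%N %| A i j)%Z].
have PP s : reflect (exists G, A = (p ^ s)%N%:Z *: G) (P s).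
  apply: (iffP idP) => [/forallP dvdA|[G eG]].
    by apply: dvdz_mxP => i j; exact: (forallP (dvdA i)).
  by apply/forallP => i; apply/forallP => j; rewrite eG mxE dvdz_mulr.
have [i [j Aij]] : exists i j, A i j != 0.
  apply: contrapT => h; case/eqP: A0; apply/matrixP => i j; rewrite mxE.
  by apply: contrapT => /eqP Aij; apply: h; exists i, j.
have exP : exists s, P s by exists S; apply/PP; exists D.
have ubP s : P s -> (s <= `|A i j|)%N.
  move=> /forallP /(_ i) /forallP /(_ j); rewrite dvdzE => dvdA.
  by rewrite (leq_trans (ltnW (ltn_expl s p1))) // dvdn_leq // absz_gt0.
case: (ex_maxnP exP ubP) => s /PP [G AG] max.
exists s, G; split=> // [|E GE]; first by apply: max; apply/PP; exists D.
suff /max : P s.+1 by rewrite ltnn.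
by apply/PP; exists E; rewrite AG GE scalerA expnSr PoszM.
Qed.

(** * The companion matrix and its eigenvectors *)

Definition companion (k : nat) (a : nat -> int) : 'M[int]_k.+2 :=
  \matrix_(i, j) if i == ord_max then (if j == 0 then 1 else a (k.+2 - j)%N)
                 else (j == i.+1 :> nat)%:R.

Lemma det_companion (k : nat) (a : nat -> int) :
  \det (companion k a) = (-1) ^+ k.+1.
Proof.
rewrite (expand_det_col _ 0) (bigD1 ord_max) //= big1 => [|i /negPf i_max].
  rewrite !mxE !eqxx mul1r addr0 /cofactor addn0 (_ : row' _ _ = 1%:M).
    by rewrite det1 mulr1.
  apply/matrixP => i j; rewrite !mxE eq_sym (negPf (neq_lift _ _)).
  by rewrite lift_max lift0 eqSS eq_sym.
by rewrite !mxE i_max mul0r.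
Qed.

(** The ring [R] is arbitrary because [y] will be both the integer sequence itself and the powers of
    a root of the characteristic polynomial. *)
Lemma companion_window (R : nzRingType) (k : nat) (a : nat -> int)
    (y : nat -> R) (n : nat) :
  y (n + k.+2)%N =
    \sum_(1 <= i < k.+2) (a i)%:~R * y (n + k.+2 - i)%N + y n ->
  map_mx intr (companion k a) *m (\col_i y (n + i)%N) = \col_i y (n.+1 + i)%N.
Proof.
move=> yk; apply/colP => i; rewrite !mxE.
under eq_bigr do rewrite !mxE.
have [->|i_max] := eqVneq i ord_max; last first.
  have i_lt : (i.+1 < k.+2)%N.
    rewrite ltn_neqAle ltn_ord andbT eqSS.
    by apply: contra i_max => /eqP i_max; apply/eqP/val_inj.
  rewrite (bigD1 (Ordinal i_lt)) //= eqxx mul1r addnS big1 ?addr0 // => j.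
  by rewrite -val_eqE /= => /negPf ->; rewrite mul0r.
rewrite addSnnS yk addrC big_ord_recl /= mul1r addn0; congr (_ + _).
rewrite big_nat_rev /= big_add1 big_mkord; apply: eq_bigr => j _.
rewrite /bump /= add1n add1n !subSS; congr (_%:~R * y _).
by move: (ltn_ord j); lia.
Qed.

(** The vector of powers [1, z, ..., z ^ k.+1] is an eigenvector for [z]; the first entry of its
    image under the [m]-th power is [z ^ m]. *)
Lemma companion_expr_eq1 (R : idomainType) (k : nat) (a : nat -> int)
    (z : R) (m : nat) :
    root (map_poly intr (recurrence_poly k.+2 a)) z ->
  companion k a ^+ m = 1 -> z ^+ m = 1.
Proof.
move=> /rootP; rewrite /recurrence_poly !rmorphB /= map_polyXn rmorph1.
rewrite !hornerE rmorph_sum horner_sum => zk Cm.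
pose f := map_mx (intr : int -> R).
pose y n : 'cV[R]_k.+2 := \col_i z ^+ (n + i).
have yS n : f _ _ (companion k a) *m y n = y n.+1.
  apply: companion_window => //; rewrite !exprD.
  move: zk => /eqP; rewrite subr_eq add0r subr_eq addrC => /eqP ->.
  rewrite mulrDr mulr1 mulr_sumr; congr (_ + _).
  rewrite !big_nat; apply: eq_bigr => i /andP[_ ik].
  rewrite /= map_polyZ map_polyXn !hornerE -addnBA ?(ltnW ik) // exprD.
  by rewrite /= [RHS]mulrCA mulrA.
have : f _ _ (companion k a ^+ m) *m y 0%N = y m.
  elim: {Cm} m => [|m IH]; first by rewrite expr0 [f _ _ _]map_mx1 mul1mx.
  by rewrite exprS [f _ _ _]map_mxM -mulmxA IH yS.
rewrite Cm [f _ _ _]map_mx1 mul1mx => /matrixP /(_ ord0 ord0).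
by rewrite !mxE /= !addn0 expr0 => <-.
Qed.

(** * Linear behaviour of the recurrence modulo powers of [p] *)

Section Recurrence.

Variables (k : nat) (a : nat -> int) (x : nat -> int).
Hypothesis x_rec : forall n, (k.+2 <= n)%N ->
  x n = \sum_(1 <= i < k.+2) a i * x (n - i)%N + x (n - k.+2)%N.
Hypothesis x_init0 : forall i, (i < k.+1)%N -> x i = 0.
Hypothesis x_init1 : x k.+1 = 1.

Local Notation C := (companion k a).
Local Notation state n := (\col_(i < k.+2) x (n + i)%N).

Lemma companionX_state m n : C ^+ m *m state n = state (m + n).
Proof.
elim: m => [|m IH]; first by rewrite expr0 mul1mx.
rewrite exprS -mulmxA IH.
have := @companion_window int k a x (m + n) _.
rewrite (_ : map_mx intr C = C) => [-> //|]; last first.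
  by apply/matrixP => i j; rewrite mxE intz.
rewrite x_rec ?leq_addl // addnK.
by congr (_ + _); apply: eq_bigr => i _; rewrite intz.
Qed.

(** As [B] commutes with [C], it sends every [C ^+ j *m state 0] to a multiple of [N]. These vectors
    form a triangular matrix with unit diagonal, which can be inverted over the integers. *)
Lemma companion_cyclic (N : int) (B : 'M[int]_k.+2) :
    B * C = C * B -> (forall i, (N %| (B *m state 0%N) i ord0)%Z) ->
  exists D, B = N *: D.
Proof.
move=> BC dvdB.
(* The columns of [V] are [state k.+1], ..., [state 0]. *)
pose V : 'M[int]_k.+2 := \matrix_(i, j) x (k.+1 - j + i)%N.
have uV : V \in unitmx.
  rewrite unitmxE det_trig; last first.
    apply/is_trig_mxP => i j ij; rewrite mxE x_init0 //.
    by move: (ltn_ord j); lia.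
  rewrite big1 ?unitr1 // => i _; rewrite mxE subnK ?x_init1 //.
  by rewrite -ltnS.
have [|w Bw] := @dvdz_mxP _ _ N (B *m state 0%N).
  by move=> i j; rewrite ord1.
exists ((\matrix_(i, j) (C ^+ (k.+1 - j) *m w) i 0) *m invmx V).
rewrite scalemxAl; apply: (canRL (mulmxK uV)).
apply/matrixP => i j; rewrite [RHS]mxE [in RHS]mxE.
have -> : (B *m V) i j = (B *m (C ^+ (k.+1 - j) *m state 0%N)) i 0.
  rewrite companionX_state addn0 !mxE.
  by apply: eq_bigr => l _; rewrite !mxE.
have /commrX BCX : GRing.comm B C by [].
rewrite mulmxA (BCX _ : B *m _ = _ *m B) -mulmxA Bw.
by rewrite -scalemxAr mxE.
Qed.

Lemma companion_expr_expansion (p e S : nat) :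
    prime p -> ~~ (p ^ e %| k.+2)%N -> (forall m, (0 < m)%N -> C ^+ m != 1) ->
  exists m s G (r : 'I_k.+2),
    [/\ (S <= s)%N, C ^+ m = 1 + (p ^ s)%N%:Z *: G, (r < k.+1)%N &
        ~~ ((p ^ e)%N %| (G *m state 0%N) r ord0)%Z].
Proof.
move=> pr_p ndvd_k C_inf; have p1 := prime_gt1 pr_p.
have uC : C \in unitmx by rewrite unitmxE det_companion unitrX ?unitrN1.
(* This forces [S <= s] and [e <= s] below; the latter makes [p ^ (2 * s)] vanish modulo
   [p ^ (s + e)]. The successor ensures [1 < p ^ M]. *)
pose M := (maxn S e).+1.
have [|l [D [l0 Cl]]] := @unitmx_exp_mod k.+1 (p ^ M) _ _ uC.
  by rewrite -(exp1n M) ltn_exp2r.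
(* Doubling the exponent makes the determinant of the power equal to 1, whatever the sign of
   [\det C]. *)
have [D' CD'] : exists D', C ^+ (l * 2) - 1 = (p ^ M)%N%:Z *: D'.
  have [w ew] := @expr1D_sqr _ ((p ^ M)%N%:Z *: D) 2.
  exists (D *+ 2 + D * ((p ^ M)%N%:Z *: D) * w).
  rewrite exprM Cl ew -[1 + _ + _]addrA [1 + _]addrC addrK.
  by rewrite scalerDr scalerMnr expr2 !scalerAl.
have m0 : (0 < l * 2)%N by rewrite muln_gt0 l0.
have [|s [G [Ms eG Gp]]] := mx_primitive_part _ _ _ _ _ p1 _ CD'.
  by rewrite subr_eq0 C_inf.
move: Ms; rewrite /M gtn_max => /andP[Ss es].
have CG : C ^+ (l * 2) = 1 + (p ^ s)%N%:Z *: G by rewrite -eG addrC subrK.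
pose g := G *m state 0%N.
have [[r [rk gr]]|h] := pselect (exists r : 'I_k.+2,
    (r < k.+1)%N /\ ~~ ((p ^ e)%N %| g r ord0)%Z).
  by exists (l * 2)%N, s, G, r; split=> //; exact: ltnW.
exfalso; set c := g ord_max ord0.
have ps0 : (p ^ s)%N%:Z != 0 by rewrite eqz_nat -lt0n expn_gt0 prime_gt0.
have GC : GRing.comm G C.
  apply/matrixP => i j; apply: (mulfI ps0).
  suff /matrixP /(_ i j) : (p ^ s)%N%:Z *: (G * C) = (p ^ s)%N%:Z *: (C * G).
    by rewrite [LHS]mxE [RHS]mxE.
  rewrite scalerAl scalerAr -eG.
  apply: commr_sym; apply: commrB; last exact: commr1.
  exact: commrX.
(* [state 0] is the last basis vector, so [g] agrees with [c] times it modulo [p ^ e]. *)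
have [||D1 GD1] := @companion_cyclic (p ^ e)%N%:Z (G - c%:M).
- by rewrite mulrBl mulrBr GC -!mulmxE scalar_mxC.
- move=> i; rewrite mulmxBl -/g mul_scalar_mx mxE.
  rewrite [X in _ + X]mxE [X in _ - X]mxE [X in _ - _ * X]mxE add0n.
  have [->|i_max] := eqVneq i ord_max.
    by rewrite x_init1 mulr1 subrr dvdz0.
  have ik : (i < k.+1)%N.
    by move: i_max (ltn_ord i); rewrite -val_eqE /=; lia.
  rewrite [x _]x_init0 // mulr0 subr0; apply: contrapT => /negP gi.
  by apply: h; exists i.
have e0 : (0 < e)%N.
  by rewrite lt0n; apply: contra ndvd_k => /eqP ->; rewrite dvd1n.
have eqG : G = c%:M + (p ^ e)%N%:Z *: D1 by rewrite -GD1 addrC subrK.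
(* Since [0 < e], a factor [p] of [c] would divide all of [G]. *)
have pc : ~~ (p %| c)%Z.
  apply/negP => /dvdzP[d cd]; apply: (Gp (d%:M + (p ^ e.-1)%N%:Z *: D1)).
  rewrite {1}eqG cd scalerDr scale_scalar_mx mulrC scalerA -PoszM -expnS.
  by rewrite prednK.
pose q := (p ^ s)%N%:Z * c.
(* Modulo [p ^ (s + e)] the power of [C] is the scalar [1 + q]. Comparing determinants gives
   [1 = 1 + k.+2 * q], as [q ^+ 2] vanishes; cancelling [p ^ s] and then [c] leaves [p ^ e] dividing
   [k.+2]. *)
have : ((p ^ (s + e))%N %| \det (C ^+ (l * 2)) - \det ((1 + q)%:M : 'M_k.+2))%Z.
  apply: (@dvdz_detB _ _ _ _ D1).
    by rewrite -(exp1n (s + e)) ltn_exp2r // addn_gt0 e0 orbT.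
  rewrite CG eqG scalerDr scale_scalar_mx scalerA addrA expnD PoszM.
  by rewrite raddfD.
have detX i : \det (C ^+ i) = (-1) ^+ (k.+1 * i).
  elim: i => [|i IH]; first by rewrite muln0 det1.
  by rewrite exprS -mulmxE det_mulmx IH det_companion mulnS exprD.
have [w ew] := @expr1D_sqr _ q k.+2.
rewrite detX mulnA exprM sqrr_sign.
rewrite det_scalar ew -addrA opprD addrA subrr add0r.
rewrite dvdzE abszN -dvdzE => dvd_q.
have dvd_q2 : ((p ^ (s + e))%N %| q ^+ 2 * w)%Z.
  rewrite /q exprMn -mulrA dvdz_mulr // expr2 -PoszM -expnD dvdzE /=.
  by rewrite dvdn_exp2l // leq_add2l ltnW.
move: dvd_q; rewrite rpredDr // -mulr_natr natz -mulrA expnD PoszM.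
rewrite dvdz_mul2l //.
rewrite Gauss_dvdzr ?dvdzE ?(negPf ndvd_k) //.
by rewrite coprimezE /= coprimeXl // prime_coprime.
Qed.

Lemma recurrence_linear_mod (p L : nat) :
    prime p -> (forall m, (0 < m)%N -> C ^+ m != 1) ->
  exists t d, ~~ ((p ^ d)%N %| t)%Z /\
    forall n : nat, exists l, ((p ^ (d + L))%N %| x l - n%:Z * t)%Z.
Proof.
move=> pr_p C_inf; pose e := k.+2.
have ndvd_k : ~~ (p ^ e %| k.+2)%N.
  by rewrite gtnNdvd // ltn_expl // prime_gt1.
have [m [s [G [r [Ls CG rk ndvd_g]]]]] :=
  companion_expr_expansion _ _ (e + L) pr_p ndvd_k C_inf.
set g := (G *m _) r _ in ndvd_g.
(* Entry [r] of [(1 + p ^ s G) ^ n] applied to [state 0] has constant term [x r = 0] and linear term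
   [n * t]. The remainder is a multiple of [p ^ (2 * s)], and [e + L <= s]. *)
exists ((p ^ s)%N%:Z * g), (s + e)%N; split.
  by rewrite expnD PoszM dvdz_mul2l // eqz_nat -lt0n expn_gt0 prime_gt0.
move=> n; exists (m * n + r)%N.
have [w ew] := expr1D_sqr _ ((p ^ s)%N%:Z *: G) n.
have := congr1 (fun A : 'M_k.+2 => (A *m state 0%N) r ord0) ew.
rewrite -CG -exprM companionX_state /= mxE addn0 => ->.
rewrite !mulmxDl mul1mx mxE [X in X + _ - _]mxE [X in X + _ + _ - _]mxE add0n.
rewrite x_init0 // add0r scalerMnl -scalemxAl [X in X + _ - _]mxE -/g.
rewrite -mulr_natl natz mulrA addrAC subrr add0r.
rewrite expr2 -scalerAl -scalerAr scalerA -scalerAl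
  -scalemxAl mxE.
rewrite dvdz_mulr // -PoszM -expnD dvdzE /= dvdn_exp2l //.
by rewrite -addnA leq_add2l.
Qed.

End Recurrence.

(** * Powers of the Pisot root, and auxiliary estimates *)

Lemma pisot_expr_neq1 (alpha z : algC) (m : nat) :
  pisot alpha -> z = alpha \/ z = - alpha -> (0 < m)%N -> z ^+ m != 1.
Proof.
move=> [_ _ alpha1 _] ez m0; apply/eqP => zm; move: (alpha1).
suff -> : alpha = 1; first by rewrite ltxx.
have alpha0 : 0 <= alpha by apply: le_trans ler01 (ltW alpha1).
have za : `|z| = alpha by case: ez => ->; rewrite ?normrN ger0_norm.
by apply/eqP; rewrite -(@eqrXn2 _ m) ?ler01 // -za -normrX zm normr1 expr1n.
Qed.

Lemma expf_inv_lt (p : nat) (r : rat) : (1 < p)%N -> 0 < r ->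
  exists L, p%:R ^- L < r.
Proof.
move=> p1 r0; exists (Num.bound r^-1).
rewrite -ltf_pV2 ?posrE ?invr_gt0 ?exprn_gt0 ?ltr0n ?(ltnW p1) // invrK.
have := archi_boundP (_ : 0 <= r^-1); rewrite invr_ge0 => /(_ (ltW r0)).
by move=> /lt_trans; apply; rewrite -natrX ltr_nat ltn_expl.
Qed.

Lemma subf_div_perturb (F : fieldType) (a b x y : F) : b != 0 -> y != 0 ->
  a / b - x / y = (a * (y - b) - b * (x - a)) / (b * y).
Proof. by move=> b0 y0; field; rewrite b0 y0. Qed.

(** * Approximation in the p-adic field *)

Section Padic.

Variables (p : nat) (hp : prime p).
Local Notation Qp := (padic hp).

Lemma padic_intr_eq0 (a : int) : ((a%:~R : Qp) == 0) = (a == 0).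
Proof.
have [->|a0] := eqVneq a 0; first by rewrite mulr0z eqxx.
apply/negbTE; rewrite -padic_abs_eq0 padic_abs_int // gt_eqF //.
by rewrite invr_gt0 exprn_gt0 // ltr0n prime_gt0.
Qed.

Lemma ratr_padic_div (a b : int) :
  b != 0 -> ratr (a%:~R / b%:~R) = (a%:~R / b%:~R : Qp).
Proof.
move=> b0; rewrite /ratr; set q : rat := a%:~R / b%:~R.
apply/eqP; rewrite eqr_div ?padic_intr_eq0 ?denq_neq0 // -!intrM.
suff -> : numq q * b = a * denq q by [].
apply/eqP; rewrite -(eqr_int rat) !intrM -eqr_div ?intr_eq0 ?denq_neq0 //.
by rewrite divq_num_den.
Qed.

Lemma padic_abs_int_le (a : int) (n : nat) :
  (padic_abs (a%:~R : Qp) <= p%:R ^- n) = ((p ^ n)%N %| a)%Z.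
Proof.
rewrite -(rmorph_int (@FracField.tofrac (padic_int hp))) padic_abs_tofrac.
rewrite padic_int_abs_le residue_int.
exact: (sameP eqP dvdz_mod0P).
Qed.

Lemma padic_int_approx (a : padic_int hp) (L : nat) :
  exists n : nat, padic_abs (n%:R - FracField.tofrac a : Qp) <= p%:R ^- L.
Proof.
have a0 : 0 <= a L.
  by rewrite -residue_mod modz_ge0 // eqz_nat expn_eq0 negb_and -lt0n prime_gt0.
exists `|a L|%N.
rewrite -tofrac1 -tofracMn -tofracB padic_abs_tofrac padic_int_abs_le.
rewrite residueD residueN pmulrn gez0_abs // residue_int residue_mod.
by rewrite modzDmr subrr mod0z.
Qed.

(** By the ultrametric inequality, [y] is too close to [b] to be smaller than it in absolute value;
    this bounds the denominator of the difference of the quotients. *)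
Lemma padic_div_dist (a b x y : Qp) (d : rat) :
    padic_abs a <= 1 -> padic_abs b <= 1 -> d < padic_abs b ->
    padic_abs (x - a) <= d -> padic_abs (y - b) <= d ->
  y != 0 /\ padic_dist (a / b) (x / y) <= d / padic_abs b ^+ 2.
Proof.
move=> a1 b1 db xa yb.
have le_by : padic_abs b <= padic_abs y.
  have := padic_absD y (b - y); rewrite addrC subrK le_max => /orP[//|].
  by rewrite -opprB padic_absN => /le_lt_trans /(_ (le_lt_trans yb db));
    rewrite ltxx.
have b_gt0 : 0 < padic_abs b.
  by apply: le_lt_trans db; apply: le_trans yb; apply: padic_abs_ge0.
have y_gt0 := lt_le_trans b_gt0 le_by.
have b0 : b != 0 by rewrite -padic_abs_eq0 gt_eqF.
have y0 : y != 0 by rewrite -padic_abs_eq0 gt_eqF.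
split=> //; rewrite /padic_dist.
have -> : a / b - x / y = (a * (y - b) - b * (x - a)) / (b * y).
  exact: subf_div_perturb.
have absV : padic_abs (b * y)^-1 = (padic_abs (b * y))^-1.
  apply: (mulIf (_ : padic_abs (b * y) != 0)).
    by rewrite padic_abs_eq0 mulf_neq0.
  rewrite -padic_absM !mulVf ?padic_abs_eq0 ?mulf_neq0 //.
  by rewrite -tofrac1 padic_abs_tofrac padic_int_abs1.
rewrite padic_absM absV padic_absM.
have d0 : 0 <= d by apply: le_trans xa; apply: padic_abs_ge0.
apply: ler_pM.
- exact: padic_abs_ge0.
- by rewrite invr_ge0 mulr_ge0 // padic_abs_ge0.
- apply: le_trans (padic_absD _ _) _; rewrite ge_max padic_absN !padic_absM.
  by rewrite -[d]mul1r !ler_pM ?padic_abs_ge0.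
- rewrite lef_pV2 ?posrE; [|exact: mulr_gt0|exact: exprn_gt0].
  by rewrite expr2 ler_wpM2l // ltW.
Qed.

(** The ratios [u / t] approximate natural numbers, hence all p-adic integers. A p-adic number is a
    quotient of two of these, and [t] cancels in the quotient of their approximations. *)
Lemma quotient_set_dense (A : set int) :
    (forall L, exists t d, ~~ ((p ^ d)%N %| t)%Z /\ forall n : nat,
       exists2 u, A u & ((p ^ (d + L))%N %| u - n%:Z * t)%Z) ->
  dense [set (ratr q : Qp) | q in quotient_set A].
Proof.
move=> approx O [y Oy] openO.
have /nbhs_ballP[r /= r0 ballO] : nbhs y O by apply: open_nbhs_nbhs.
have [a [b [b0 ey]]] := padic_fracP y.
set b' := FracField.tofrac b in ey; set a' := FracField.tofrac a in ey.
have babs : 0 < padic_abs b'.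
  by rewrite lt_neqAle padic_abs_ge0 andbT eq_sym padic_abs_eq0 tofrac_eq0.
have le1 (c : padic_int hp) : padic_abs (FracField.tofrac c) <= 1.
  rewrite padic_abs_tofrac -invr1 -(expr0 p%:R) padic_int_abs_le.
  by rewrite -residue_mod modz1.
(* The first bound keeps the approximate denominator nonzero; the second brings the error of the
   quotient below [r]. *)
pose d := Num.min (padic_abs b') (r * padic_abs b' ^+ 2).
have d0 : 0 < d by rewrite lt_min babs; apply: mulr_gt0 => //; apply: exprn_gt0.
have [L] := expf_inv_lt p d (prime_gt1 hp) d0.
rewrite lt_min => /andP[Lb Lr].
have [t [e [ndvd_t tL]]] := approx L.
have t0 : t != 0 by apply: contraNneq ndvd_t => ->; apply: dvdz0.
have near (c : padic_int hp) : exists2 u, A u &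
    padic_abs (u%:~R / t%:~R - FracField.tofrac c : Qp) <= p%:R ^- L.
  have [n cn] := padic_int_approx c L; have [u Au un] := tL n.
  exists u => //.
  have -> : u%:~R / t%:~R - FracField.tofrac c =
      (u - n%:Z * t)%:~R / t%:~R + (n%:R - FracField.tofrac c) :> Qp.
    rewrite rmorphB rmorphM /= mulrBl mulfK ?padic_intr_eq0 // -pmulrn.
    by rewrite addrA subrK.
  apply: le_trans (padic_absD _ _) _; rewrite ge_max cn andbT.
  (* Dividing by [t], whose absolute value exceeds [p ^- e], costs less than the factor [p ^ e]
     gained in [un]. *)
  move: un ndvd_t; rewrite -!padic_abs_int_le -ltNge exprD invfM => un lt_t.
  have e0 : 0 < p%:R ^- e :> rat.
    by rewrite invr_gt0 exprn_gt0 // ltr0n prime_gt0.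
  rewrite -(ler_pM2l (lt_trans e0 lt_t)) -padic_absM mulrC.
  rewrite divfK ?padic_intr_eq0 //.
  apply: le_trans un _; apply: ler_wpM2r; last exact: ltW.
  by rewrite invr_ge0 exprn_ge0 // ler0n.
have [u Au ua] := near a; have [v Av vb] := near b.
have [vt0 dist] := padic_div_dist _ _ _ _ _ (le1 a) (le1 b) Lb ua vb.
have v0 : v != 0.
  by apply: contraNneq vt0 => ->; rewrite mulr0z mul0r.
exists (u%:~R / v%:~R); split.
  apply: ballO; rewrite ballEmdist /=.
  rewrite (_ : u%:~R / v%:~R = u%:~R / t%:~R / (v%:~R / t%:~R)); last first.
    by rewrite invf_div mulrA divfK // padic_intr_eq0.
  rewrite ey; apply: le_lt_trans dist _.
  by rewrite ltr_pdivrMr ?exprn_gt0.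
exists (u%:~R / v%:~R); first by exists u, v.
exact: ratr_padic_div.
Qed.

End Padic.

Theorem theorem1p3 (k : nat) (hk : (2 <= k)%N) (a : nat -> int) (x : nat -> int)
    (x_rec : forall n : nat, (k <= n)%N ->
       x n = \sum_(1 <= i < k) a i * x (n - i)%N + x (n - k)%N)
    (x_init0 : forall i : nat, (i < k.-1)%N -> x i = 0)
    (x_init1 : x k.-1 = 1)
    (pisot_root : exists alpha : algC, pisot alpha /\
       (root (map_poly intr (recurrence_poly k a)) alpha \/
        root (map_poly intr (recurrence_poly k a)) (- alpha)))
    (p : nat) (hp : prime p)
    (irr : irreducible_poly
       (map_poly intr (recurrence_poly k a) : {poly padic hp})) :
  dense [set (ratr q : padic hp) | q in quotient_set (range x)].
Proof.
case: k hk x_rec x_init0 x_init1 pisot_root irr => [|[|k]] // _.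
move=> x_rec x_init0 x_init1 [alpha [pisot_alpha alpha_root]] _.
have [z ez z_root] : exists2 z, z = alpha \/ z = - alpha &
    root (map_poly intr (recurrence_poly k.+2 a)) z.
  case: alpha_root => ?; first by exists alpha; first left.
  by exists (- alpha); first right.
apply: quotient_set_dense => L.
have [m m0|t [d [ndvd_t tL]]] :=
  recurrence_linear_mod _ a _ x_rec x_init0 x_init1 p L hp.
  (* A power of the companion matrix equal to 1 would force [z ^+ m = 1]. *)
  apply/eqP => /(companion_expr_eq1 _ _ _ _ _ z_root); apply/eqP.
  exact: pisot_expr_neq1 pisot_alpha ez m0.
exists t, d; split=> // n; have [l dvd_l] := tL n.
by exists (x l); first exists l.
Qed.
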